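(* Let $I=(-1,1)$ and let $*_{\mathtt p}$ be the convolution on $L^2_{\mathbb{C}}(I)$ associated to the Hilbert basis $e_k(x)=\frac1{\sqrt2}e^{i\pi kx}$, $k\in\mathbb{Z}$, i.e. $C*_{\mathtt p}u=\sum_{k\in\mathbb{Z}}\langle e_k|C\rangle\langle e_k|u\rangle e_k$. Then for all $C,u\in L^2_{\mathbb{C}}(I)$ and $x\in I$ $$(C*_{\mathtt p}u)(x)=\frac1{\sqrt2}\int_{-1}^1\hat C_{\mathtt p}(x-y)\,u(y)\,dy ,$$ where $\hat C_{\mathtt p}$ denotes the extension of $C$ to a $2$-periodic function on $\mathbb{R}$.
   Context: $\langle g|h\rangle=\int_{-1}^1g^*(y)h(y)\,dy$ with $^*$ complex conjugation. The value $(C*_{\mathtt p}u)(x)$ is the sum of the (absolutely convergent) series $\sum_{k\in\mathbb{Z}}\langle e_k|C\rangle\langle e_k|u\rangle e_k(x)$. The $e_k$ are the normalized eigenfunctions of $-\frac1{\pi^2}\frac{d^2}{dx^2}$ on $I$ with periodic boundary conditions. *)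

(* Defs.v *)
From HB Require Import structures.
From mathcomp Require Import all_boot all_order all_algebra.
From mathcomp Require Import all_classical all_reals all_analysis.
From mathcomp Require Import complex.
From mathcomp Require summability.

Set Implicit Arguments.
Unset Strict Implicit.
Unset Printing Implicit Defensive.

Import Order.TTheory GRing.Theory Num.Theory numFieldNormedType.Exports.

Local Open Scope classical_set_scope.
Local Open Scope ring_scope.
Local Open Scope complex_scope.

Section PeriodicConvolution.
Context {R : realType}.
Implicit Types (f g h C u : R -> R[i]) (D : set R) (t x y : R).

Local Notation mu := (@lebesgue_measure R).

Definition cintegrable D f : Prop :=
  mu.-integrable D (EFin \o (fun y => complex.Re (f y))) /\
  mu.-integrable D (EFin \o (fun y => complex.Im (f y))).

Definition cintegral D f : R[i] :=
  Rintegral mu D (fun y => complex.Re (f y)) +i*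
  Rintegral mu D (fun y => complex.Im (f y)).

Definition domI : set R := `]-1, 1[%classic.

(* An element of L^2(domI) is given by a representative defined on all of R,
   of which only the restriction to domI is constrained. *)
Definition L2 f : Prop :=
  [/\ measurable_fun domI (fun y => complex.Re (f y)),
      measurable_fun domI (fun y => complex.Im (f y))
    & mu.-integrable domI (EFin \o (fun y => Normc.normc (f y) ^+ 2))].

Definition braket g h : R[i] := cintegral domI (fun y => conjc (g y) * h y).

Definition expi t : R[i] := cos t +i* sin t.

Definition fourier (k : int) x : R[i] :=
  (Num.sqrt 2)^-1%:C * expi (pi * k%:~R * x).

Definition conv_term (b : int -> R -> R[i]) C u x (k : int) : R[i] :=
  braket (b k) C * braket (b k) u * b k x.

Definition abs_summable (a : int -> R[i]) : Prop :=
  summable [set: int] (fun k => (Normc.normc (a k))%:E).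

(* Convolution associated to the basis b.  The series is summed along the
   filter of finite subsets of int; R[i]^o carries the usual topology of
   the complex numbers. *)
Definition basis_conv (b : int -> R -> R[i]) C u x : R[i] :=
  summability.sum (conv_term b C u x : int -> R[i]^o).

(* The value of a 2-periodic extension at the odd integers is left free:
   they are the translates of the endpoints of the open interval domI. *)
Definition periodic_extension C (Chat : R -> R[i]) : Prop :=
  periodic Chat 2 /\ (forall t, domI t -> Chat t = C t).

End PeriodicConvolution.

(* Main.v *)
Require Import Defs.
From HB Require Import structures.
From mathcomp Require Import all_boot all_order all_algebra.
From mathcomp Require Import finmap.
From mathcomp Require Import all_classical all_reals all_analysis.
From mathcomp Require Import measurable_realfun complex ring lra.
From mathcomp Require summability.
Import Order.TTheory GRing.Theory Num.Theory numFieldNormedType.Exports.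

Set Implicit Arguments.
Unset Strict Implicit.
Unset Printing Implicit Defensive.

Local Open Scope classical_set_scope.
Local Open Scope ring_scope.
Local Open Scope complex_scope.

(** The trigonometric system is complete in L^2(-1,1): trigonometric polynomials
    form an algebra, the polynomials (1 - q^n)^(2^n) send values q < 1/2 to 1
    and values q > 1/2 to 0 in the limit, and for a suitable trigonometric
    polynomial q with values in [0,1] one has q < 1/2 exactly on (a,1) in (-1,1).  By
    dominated convergence the indicators of rays are L^2-limits of trigonometric
    polynomials, and Dynkin's theorem extends this to all measurable sets, hence
    to simple functions and to L^2.  Together with Bessel's inequality this gives
    Parseval's identity for the pairing of v(y) = conj(Chat(x - y)) with u.  By
    reflection and periodicity the coefficients satisfy
    conj<e_k|v> = sqrt 2 <e_k|C> e_k(x), so Parseval's sum is the series defining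
    the convolution, up to the factor sqrt 2. *)

(** * Complex-valued integrals and the pairing on L^2 *)

Section ComplexIntegral.
Context {R : realType}.
Implicit Types (f g h : R -> R[i]) (c z w : R[i]).
Local Notation mu := (@lebesgue_measure R).
(* The domain of mu is measurableTypeR R, whose measurable structure is
   convertible to that of R but carries another display. *)
Local Notation D := (@domI R : set (measurableTypeR R)).

Lemma measurable_domI : measurable D.
Proof. exact: measurable_itv. Qed.
Hint Resolve measurable_domI : core.

Lemma mu_domI : mu D = 2%:E.
Proof.
rewrite /domI lebesgue_measure_itv/= lte_fin ifT; last by lra.
by rewrite -EFinB; congr EFin; lra.
Qed.

Lemma sqr_normc z : Normc.normc z ^+ 2 = complex.Re z ^+ 2 + complex.Im z ^+ 2.
Proof. by case: z => a b /=; rewrite sqr_sqrtr// addr_ge0// sqr_ge0. Qed.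

Lemma normc_ge0 z : 0 <= Normc.normc z.
Proof. by case: z => a b /=; rewrite sqrtr_ge0. Qed.

Lemma normcJ z : Normc.normc (conjc z) = Normc.normc z.
Proof. by case: z => a b /=; rewrite sqrrN. Qed.

Lemma normr_Re_le z : `|complex.Re z| <= Normc.normc z.
Proof.
case: z => a b /=; rewrite -(sqrtr_sqr a) ler_sqrt ?lerDl ?sqr_ge0//.
by rewrite addr_ge0// sqr_ge0.
Qed.

Lemma normr_Im_le z : `|complex.Im z| <= Normc.normc z.
Proof.
case: z => a b /=; rewrite -(sqrtr_sqr b) ler_sqrt ?lerDr ?sqr_ge0//.
by rewrite addr_ge0// sqr_ge0.
Qed.

Lemma normc_le_ReIm z : Normc.normc z <= `|complex.Re z| + `|complex.Im z|.
Proof.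
rewrite -(@ler_pXn2r _ 2) ?nnegrE ?addr_ge0 ?normc_ge0// sqr_normc.
rewrite sqrrD !real_normK ?num_real// lerD2r lerDl mulrn_wge0// mulr_ge0//.
Qed.

Lemma normc_sum (I : Type) (s : seq I) (F : I -> R[i]) :
  Normc.normc (\sum_(i <- s) F i) <= \sum_(i <- s) Normc.normc (F i).
Proof.
elim/big_ind2: _ => //; first by rewrite Normc.normc0.
by move=> a b a' b' H H'; rewrite (le_trans (le_normcD _ _))// lerD.
Qed.

Lemma Re_mulc z w : complex.Re (z * w) =
  complex.Re z * complex.Re w - complex.Im z * complex.Im w.
Proof. by case: z => ? ?; case: w. Qed.

Lemma Im_mulc z w : complex.Im (z * w) =
  complex.Re z * complex.Im w + complex.Im z * complex.Re w.
Proof. by case: z => ? ?; case: w. Qed.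

Lemma Re_addc z w : complex.Re (z + w) = complex.Re z + complex.Re w.
Proof. by case: z => ? ?; case: w. Qed.

Lemma Im_addc z w : complex.Im (z + w) = complex.Im z + complex.Im w.
Proof. by case: z => ? ?; case: w. Qed.

Lemma Re_conjc z : complex.Re (conjc z) = complex.Re z. Proof. by case: z. Qed.

Lemma Im_conjc z : complex.Im (conjc z) = - complex.Im z. Proof. by case: z. Qed.

Lemma complex_ext z w :
  complex.Re z = complex.Re w -> complex.Im z = complex.Im w -> z = w.
Proof. by case: z => ? ?; case: w => ? ? /= -> ->. Qed.

Definition cmeasurable f :=
  measurable_fun D (fun y => complex.Re (f y)) /\
  measurable_fun D (fun y => complex.Im (f y)).

Lemma cmeasurableD f g : cmeasurable f -> cmeasurable g ->
  cmeasurable (fun y => f y + g y).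
Proof.
move=> [fr fi] [gr gi]; split.
  by under eq_fun do rewrite Re_addc; exact: measurable_funD.
by under eq_fun do rewrite Im_addc; exact: measurable_funD.
Qed.

Lemma cmeasurableM f g : cmeasurable f -> cmeasurable g ->
  cmeasurable (fun y => f y * g y).
Proof.
move=> [fr fi] [gr gi]; split.
  by under eq_fun do rewrite Re_mulc; apply: measurable_funB; exact: measurable_funM.
by under eq_fun do rewrite Im_mulc; apply: measurable_funD; exact: measurable_funM.
Qed.

Lemma cmeasurable_cst c : cmeasurable (fun=> c).
Proof. by split; exact: measurable_cst. Qed.

Lemma cmeasurableZ c f : cmeasurable f -> cmeasurable (fun y => c * f y).
Proof. by move=> mf; apply: cmeasurableM => //; exact: cmeasurable_cst. Qed.

Lemma cmeasurableB f g : cmeasurable f -> cmeasurable g ->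
  cmeasurable (fun y => f y - g y).
Proof.
move=> mf mg; under eq_fun do rewrite -mulN1r.
by apply: cmeasurableD => //; exact: cmeasurableZ.
Qed.

Lemma cmeasurableJ f : cmeasurable f -> cmeasurable (fun y => conjc (f y)).
Proof.
move=> [fr fi]; split.
  by under eq_fun do rewrite Re_conjc.
by under eq_fun do rewrite Im_conjc; apply: measurableT_comp.
Qed.

Lemma cmeasurable_real (f : R -> R) : measurable_fun D f ->
  cmeasurable (fun y => (f y)%:C).
Proof. by move=> mf; split => //=; exact: measurable_cst. Qed.

Lemma measurable_sqr_normc f : cmeasurable f ->
  measurable_fun D (fun y => Normc.normc (f y) ^+ 2).
Proof.
move=> [mr mi]; under eq_fun do rewrite sqr_normc.
by apply: measurable_funD; exact: measurable_funX.
Qed.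

Lemma cintegrable_le f (h : R -> R) : cmeasurable f ->
  mu.-integrable D (EFin \o h) ->
  (forall y, D y -> Normc.normc (f y) <= h y) -> cintegrable D f.
Proof.
move=> [mr mi] ih fh; split; apply: (le_integrable measurable_domI _ _ ih).
- exact/measurable_EFinP.
- move=> y Dy; rewrite /= lee_fin (le_trans (normr_Re_le _))//.
  by rewrite (le_trans (fh _ Dy))// ler_norm.
- exact/measurable_EFinP.
- move=> y Dy; rewrite /= lee_fin (le_trans (normr_Im_le _))//.
  by rewrite (le_trans (fh _ Dy))// ler_norm.
Qed.

Lemma cintegralD f g : cintegrable D f -> cintegrable D g ->
  cintegral D (fun y => f y + g y) = cintegral D f + cintegral D g.
Proof.
move=> [fr fi] [gr gi]; apply: complex_ext => /=.
  by under eq_Rintegral do rewrite Re_addc; exact: RintegralD.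
by under eq_Rintegral do rewrite Im_addc; exact: RintegralD.
Qed.

Lemma integrable_domI_scale (r : R) (f : R -> R) : mu.-integrable D (EFin \o f) ->
  mu.-integrable D (EFin \o (fun y => r * f y)).
Proof. by move=> hf; exact: (integrableZl measurable_domI r hf). Qed.

Lemma cintegralZ c f : cintegrable D f ->
  cintegral D (fun y => c * f y) = c * cintegral D f.
Proof.
move=> [fr fi]; apply: complex_ext; rewrite /cintegral.
  rewrite Re_mulc /=; under eq_Rintegral do rewrite Re_mulc.
  by rewrite RintegralB ?RintegralZl//; exact: integrable_domI_scale.
rewrite Im_mulc /=; under eq_Rintegral do rewrite Im_mulc.
by rewrite RintegralD ?RintegralZl//; exact: integrable_domI_scale.
Qed.

Lemma cintegralJ f : cintegrable D f ->
  cintegral D (fun y => conjc (f y)) = conjc (cintegral D f).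
Proof.
move=> [fr fi]; apply: complex_ext; rewrite /cintegral /=.
  by under eq_Rintegral do rewrite Re_conjc.
under eq_Rintegral do rewrite Im_conjc -mulN1r.
by rewrite RintegralZl// mulN1r.
Qed.

Lemma eq_cintegral f g : (forall y, D y -> f y = g y) ->
  cintegral D f = cintegral D g.
Proof.
by move=> fg; apply: complex_ext; rewrite /cintegral /=;
  apply: eq_Rintegral => y /set_mem Dy; rewrite fg.
Qed.

(** The real and imaginary parts are bounded separately, each by the integral of [h], which is where
    the factor 2 comes from. *)
Lemma normc_cintegral_le f (h : R -> R) : cmeasurable f ->
  mu.-integrable D (EFin \o h) ->
  (forall y, D y -> Normc.normc (f y) <= h y) ->
  Normc.normc (cintegral D f) <= 2 * Rintegral mu D h.
Proof.
move=> mf ih fh; have [fr fi] := cintegrable_le mf ih fh.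
rewrite (le_trans (normc_le_ReIm _))// mulr2n mulrDl mul1r lerD//=.
  rewrite (le_trans (le_normr_Rintegral measurable_domI fr))//.
  apply: le_Rintegral => //; first exact: integrable_norm.
  by move=> y Dy; rewrite (le_trans (normr_Re_le _))// fh.
rewrite (le_trans (le_normr_Rintegral measurable_domI fi))//.
apply: le_Rintegral => //; first exact: integrable_norm.
by move=> y Dy; rewrite (le_trans (normr_Im_le _))// fh.
Qed.

Lemma L2P f : L2 f <-> cmeasurable f /\
  mu.-integrable D (EFin \o (fun y => Normc.normc (f y) ^+ 2)).
Proof. by split=> [[mr mi jf]|[[mr mi] jf]]; do ?split; assumption. Qed.

Lemma L2_cmeasurable f : L2 f -> cmeasurable f.
Proof. by case/L2P. Qed.

Lemma L2_le f (h : R -> R) : cmeasurable f -> mu.-integrable D (EFin \o h) ->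
  (forall y, D y -> Normc.normc (f y) ^+ 2 <= h y) -> L2 f.
Proof.
move=> mf ih fh; apply/L2P; split=> //; apply: (le_integrable measurable_domI _ _ ih).
  by apply/measurable_EFinP; exact: (measurable_sqr_normc mf).
move=> y Dy; rewrite /= lee_fin ger0_norm ?sqr_ge0//.
by rewrite (le_trans (fh _ Dy))// ler_norm.
Qed.

Lemma integrable_domI_cst (r : R) : mu.-integrable D (EFin \o cst r).
Proof.
apply: (@measurable_bounded_integrable _ _ _ mu _ D measurable_domI).
- by rewrite [X in (X < _)%E](_ : _ = mu D)// mu_domI ltry.
- exact: measurable_cst.
- by exists `|r|; split; [exact: num_real|move=> M rM y Dy /=; exact: ltW].
Qed.

Lemma L2_bounded f (M : R) : cmeasurable f ->
  (forall y, D y -> Normc.normc (f y) <= M) -> L2 f.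
Proof.
move=> mf fM; apply: (L2_le (h := cst (M ^+ 2))) => //.
  exact: integrable_domI_cst.
by move=> y Dy; rewrite /= ler_pXn2r ?nnegrE ?normc_ge0 ?fM// (le_trans _ (fM y Dy)) ?normc_ge0.
Qed.

Lemma L2Z c f : L2 f -> L2 (fun y => c * f y).
Proof.
case/L2P => mf jf; apply: (L2_le (cmeasurableZ c mf)
  (integrable_domI_scale (Normc.normc c ^+ 2) jf)) => y Dy.
by rewrite Normc.normcM exprMn.
Qed.

Lemma integrable_domI_add (f g : R -> R) : mu.-integrable D (EFin \o f) ->
  mu.-integrable D (EFin \o g) -> mu.-integrable D (EFin \o (fun y => f y + g y)).
Proof. by move=> hf hg; exact: (integrableD measurable_domI hf hg). Qed.

Lemma sqr_normcD_le z w : Normc.normc (z + w) ^+ 2 <=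
  2 * Normc.normc z ^+ 2 + 2 * Normc.normc w ^+ 2.
Proof.
rewrite !sqr_normc Re_addc Im_addc; case: z => a b; case: w => a' b' /=.
have := sqr_ge0 (a - a'); have := sqr_ge0 (b - b'); nra.
Qed.

Lemma L2D f g : L2 f -> L2 g -> L2 (fun y => f y + g y).
Proof.
case/L2P => mf jf /L2P[mg jg].
apply: (L2_le (cmeasurableD mf mg)
  (integrable_domI_add (integrable_domI_scale 2 jf) (integrable_domI_scale 2 jg))) => y Dy.
exact: sqr_normcD_le.
Qed.

Lemma L2B f g : L2 f -> L2 g -> L2 (fun y => f y - g y).
Proof.
by move=> hf hg; under eq_fun do rewrite -mulN1r; apply: L2D => //; exact: L2Z.
Qed.

Lemma L2J f : L2 f -> L2 (fun y => conjc (f y)).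
Proof.
case/L2P => mf jf; apply: (L2_le (cmeasurableJ mf) jf) => y Dy.
by rewrite normcJ.
Qed.

(** Weighted AM-GM: with a, b the moduli, the difference of the two sides is s (a - b / s)^2. The
    free weight [s] lets later estimates do without Cauchy-Schwarz. *)
Lemma normc_mul_le z w (s : R) : 0 < s ->
  2 * Normc.normc (conjc z * w) <= s * Normc.normc z ^+ 2 + s^-1 * Normc.normc w ^+ 2.
Proof.
move=> s0; rewrite Normc.normcM normcJ.
set a := Normc.normc z; set b := Normc.normc w.
rewrite -subr_ge0 (_ : _ - _ = s * (a - s^-1 * b) ^+ 2).
  by rewrite mulr_ge0 ?sqr_ge0// ltW.
by field; rewrite gt_eqF.
Qed.

Lemma integrable_AMGM f g (s : R) : L2 f -> L2 g ->
  mu.-integrable D (EFin \o (fun y => s * Normc.normc (f y) ^+ 2 + s^-1 * Normc.normc (g y) ^+ 2)).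
Proof.
by case/L2P => mf jf /L2P[mg jg]; apply: integrable_domI_add; exact: integrable_domI_scale.
Qed.

Lemma L2_cintegrable f g : L2 f -> L2 g -> cintegrable D (fun y => conjc (f y) * g y).
Proof.
move=> hf hg; have mf := L2_cmeasurable hf; have mg := L2_cmeasurable hg.
apply: (cintegrable_le (cmeasurableM (cmeasurableJ mf) mg) (integrable_AMGM 1 hf hg)) => y Dy.
have := normc_mul_le (f y) (g y) (@ltr01 R); have := normc_ge0 (conjc (f y) * g y).
by move: (Normc.normc (conjc (f y) * g y)) => a; lra.
Qed.

Lemma braketDr f g h : L2 f -> L2 g -> L2 h ->
  braket f (fun y => g y + h y) = braket f g + braket f h.
Proof.
move=> hf hg hh; rewrite /braket; under eq_fun do rewrite mulrDr.
by rewrite cintegralD//; exact: L2_cintegrable.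
Qed.

Lemma braketZr c f g : L2 f -> L2 g ->
  braket f (fun y => c * g y) = c * braket f g.
Proof.
move=> hf hg; rewrite /braket; under eq_fun do rewrite mulrCA.
by rewrite cintegralZ//; exact: L2_cintegrable.
Qed.

Lemma braketJ f g : L2 f -> L2 g -> conjc (braket f g) = braket g f.
Proof.
move=> hf hg; rewrite /braket -cintegralJ; last exact: L2_cintegrable.
apply: eq_cintegral => y _.
by apply: complex_ext; rewrite ?(Re_conjc, Re_mulc, Im_conjc, Im_mulc); ring.
Qed.

(** Conjugate symmetry carries additivity over from the second argument. *)
Lemma braketDl f g h : L2 f -> L2 g -> L2 h ->
  braket (fun y => f y + g y) h = braket f h + braket g h.
Proof.
move=> hf hg hh; rewrite -braketJ//; last exact: L2D.
by rewrite braketDr// rmorphD; congr (_ + _); exact: braketJ.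
Qed.

Lemma braketZl c f g : L2 f -> L2 g ->
  braket (fun y => c * f y) g = conjc c * braket f g.
Proof.
move=> hf hg; rewrite -braketJ//; last exact: L2Z.
by rewrite braketZr// rmorphM; congr (_ * _); exact: braketJ.
Qed.

Lemma braketBr f g h : L2 f -> L2 g -> L2 h ->
  braket f (fun y => g y - h y) = braket f g - braket f h.
Proof.
move=> hf hg hh; under [in LHS]eq_fun do rewrite -mulN1r.
by rewrite braketDr ?braketZr ?mulN1r//; exact: L2Z.
Qed.

Lemma braketBl f g h : L2 f -> L2 g -> L2 h ->
  braket (fun y => f y - g y) h = braket f h - braket g h.
Proof.
move=> hf hg hh; under [in LHS]eq_fun do rewrite -mulN1r.
rewrite braketDl ?braketZl//; last exact: L2Z.
by rewrite rmorphN1 mulN1r.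
Qed.

Definition sqnorm f : R := Rintegral mu D (fun y => Normc.normc (f y) ^+ 2).

Lemma sqnorm_ge0 f : 0 <= sqnorm f.
Proof. by apply: Rintegral_ge0 => y _; exact: sqr_ge0. Qed.

Lemma braket_diag f : braket f f = (sqnorm f)%:C.
Proof.
apply: complex_ext; rewrite /braket /cintegral/=.
  apply: eq_Rintegral => y _; rewrite sqr_normc; case: (f y) => a b /=; ring.
under eq_Rintegral => y _ do rewrite Im_mulc Re_conjc Im_conjc mulrC mulNr subrr.
by rewrite Rintegral_cst// mul0r.
Qed.

(** Substitute for Cauchy-Schwarz: the factor 2 of [normc_cintegral_le] cancels the one on the left
    of [normc_mul_le]. *)
Lemma normc_braket_le f g (s : R) : L2 f -> L2 g -> 0 < s ->
  Normc.normc (braket f g) <= s * sqnorm f + s^-1 * sqnorm g.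
Proof.
move=> hf hg s0; have mf := L2_cmeasurable hf; have mg := L2_cmeasurable hg.
have [_ jf] := (L2P f).1 hf; have [_ jg] := (L2P g).1 hg.
have H := integrable_domI_scale 2^-1 (integrable_AMGM s hf hg).
apply: (le_trans (normc_cintegral_le (cmeasurableM (cmeasurableJ mf) mg) H _)).
  by move=> y Dy; have := normc_mul_le (f y) (g y) s0; lra.
rewrite RintegralZl//; last exact: integrable_AMGM.
rewrite mulrA divff ?mul1r// RintegralD//; try exact: integrable_domI_scale.
by rewrite !RintegralZl.
Qed.

End ComplexIntegral.

(** * Integrals of 2-periodic functions *)

Section Reflection.
Context {R : realType}.
Local Notation mu := (@lebesgue_measure R).
Local Notation D := (@domI R : set (measurableTypeR R)).
Local Open Scope ereal_scope.

Definition reflect_at (c : R) : measurableTypeR R -> measurableTypeR R :=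
  fun y => (c - y)%R.

Lemma measurable_reflect_at c : measurable_fun setT (reflect_at c).
Proof. by apply: measurable_funB => //; exact: measurable_cst. Qed.

HB.instance Definition _ c :=
  isMeasurableFun.Build _ _ _ _ (reflect_at c) (measurable_reflect_at c).

(** By uniqueness of Lebesgue measure only intervals ]a, b] need checking; the preimage [c - b, c -
    a[ has the same length. *)
Lemma lebesgue_measure_reflect c (A : set (measurableTypeR R)) :
  measurable A -> pushforward mu (reflect_at c) A = mu A.
Proof.
move=> mA; apply/esym/lebesgue_measure_unique => //= _ [[a b]] _ <-.
rewrite /pushforward [X in _ = mu X](_ : _ = `[(c - b)%R, (c - a)%R[%classic); last first.
  by apply/seteqP; split => y; rewrite /= /reflect_at !in_itv/= => /andP[? ?];
    apply/andP; split; lra.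
rewrite !lebesgue_measure_itv/= !lte_fin -!EFinB.
by rewrite (_ : (c - b < c - a)%R = (a < b)%R) ?opprB ?addrA; [congr (if _ then (_)%:E else _); ring|lra].
Qed.

Lemma ge0_integral_reflect c (A : set (measurableTypeR R)) (f : R -> \bar R) :
  measurable A -> measurable_fun A f -> (forall y, 0 <= f y) ->
  \int[mu]_(y in reflect_at c @^-1` A) f (c - y)%R = \int[mu]_(y in A) f y.
Proof.
move=> mA mf f0.
rewrite -(ge0_integral_pushforward (measurable_reflect_at c) mu mA mf) => [|y _]; last exact: f0.
by apply: eq_measure_integral => B mB _; exact: lebesgue_measure_reflect.
Qed.

Lemma ge0_integral_itv_reflect (a b c : R) (f : R -> \bar R) :
  measurable_fun setT f -> (forall y, 0 <= f y) ->
  \int[mu]_(y in `]a, b[) f (c - y)%R = \int[mu]_(y in `](c - b)%R, (c - a)%R[) f y.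
Proof.
move=> mf f0; rewrite -[RHS](ge0_integral_reflect c) //; last first.
  exact: (measurable_funTS mf).
congr (integral _ _ _); apply/seteqP; split => y /=;
  rewrite /reflect_at !in_itv/= => /andP[? ?]; apply/andP; split; lra.
Qed.

Lemma ge0_integral_itv_split (a b c : R) (f : R -> \bar R) :
  measurable_fun setT f -> (forall y, 0 <= f y) -> (a <= b)%R -> (b <= c)%R ->
  \int[mu]_(y in `]a, c[) f y =
  \int[mu]_(y in `]a, b[) f y + \int[mu]_(y in `]b, c[) f y.
Proof.
move=> mf f0 ab bc.
(* The decomposition below cuts just before [b], which requires [a] to lie strictly to the left; the
   point [b] itself is a null set. *)
have [->|ab'] := eqVneq a b.
  by rewrite [in RHS]set_itv_ge ?bnd_simp ?ltxx// integral_set0 add0e.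
have ab'' : (a < b)%R by rewrite lt_neqAle ab'.
rewrite (@itv_bndbnd_setU _ _ _ (BLeft b)) ?bnd_simp//.
rewrite ge0_integral_setU//.
- rewrite (@integral_itv_obnd_cbnd _ b)//; exact: (measurable_funTS mf).
- exact: (measurable_funTS mf).
- apply/disj_setPS => y [/=]; rewrite 2!in_itv/= => /andP[_ yx] /andP[].
  by rewrite leNgt yx.
Qed.

(** The windows ]a, a + 2[ and ]-1, 1[ overlap, and what is left of one is the translate by 2 of
    what is left of the other. The range of [a] suffices for a = x - 1 with x in [domI]. *)
Lemma ge0_integral_periodic (a : R) (f : R -> \bar R) :
  measurable_fun setT f -> (forall y, 0 <= f y) -> (forall y, f (y + 2)%R = f y) ->
  (-2 <= a)%R -> (a <= 0)%R ->
  \int[mu]_(y in `]a, (a + 2)%R[) f y = \int[mu]_(y in `](-1)%R, 1%R[) f y.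
Proof.
move=> mf f0 pf a2 a0.
(* A translation by 2 is a composition of the reflections y -> 2 - y and y -> 0 - y, whose
   integrands agree by periodicity. *)
have shift b c : \int[mu]_(y in `](b + 2)%R, (c + 2)%R[) f y =
    \int[mu]_(y in `]b, c[) f y.
  have := @ge0_integral_itv_reflect (- c) (- b) 2 f mf f0.
  rewrite !opprK ![(2 + _)%R]addrC => <-.
  have := @ge0_integral_itv_reflect (- c) (- b) 0 f mf f0.
  rewrite !opprK !add0r => <-.
  by apply: eq_integral => y _; rewrite -(pf (0 - y)%R); congr f; ring.
have [a1|/ltW a1] := leP (-1)%R a.
  have a1' : (a <= 1)%R by lra.
  have a2' : (1 <= a + 2)%R by lra.
  rewrite (@ge0_integral_itv_split _ 1)//.
  rewrite (@ge0_integral_itv_split (-1) a)//.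
  rewrite addeC; congr (_ + _).
  have e1 : (-1 + 2 = 1 :> R)%R by lra.
  by rewrite -(shift (-1)%R a) e1.
have a1' : (a + 2 <= 1)%R by lra.
have a2' : (-1 <= a + 2)%R by lra.
rewrite (@ge0_integral_itv_split a (-1))//.
rewrite (@ge0_integral_itv_split (-1) (a + 2) 1)//.
rewrite addeC; congr (_ + _).
have e1 : (-1 + 2 = 1 :> R)%R by lra.
by rewrite -(shift a (-1)%R) e1.
Qed.

(** The reflection carries ]-1, 1[ onto ]x - 1, x + 1[, again a full period. *)
Lemma ge0_integral_domI_periodic (x : R) (f : R -> \bar R) :
  measurable_fun setT f -> (forall y, 0 <= f y) -> (forall y, f (y + 2)%R = f y) -> D x ->
  \int[mu]_(y in D) f (x - y)%R = \int[mu]_(y in D) f y.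
Proof.
move=> mf f0 pf; rewrite /domI /= in_itv/= => /andP[x1 x2].
have x1' : (-2 <= x - 1)%R by lra.
have x2' : (x - 1 <= 0)%R by lra.
rewrite ge0_integral_itv_reflect// opprK -[RHS](ge0_integral_periodic (a := (x - 1)%R))//.
by rewrite (_ : (x - 1 + 2)%R = (x + 1)%R)//; ring.
Qed.

Lemma integral_domI_periodic (x : R) (f : R -> \bar R) :
  measurable_fun setT f -> (forall y, f (y + 2)%R = f y) -> D x ->
  \int[mu]_(y in D) f (x - y)%R = \int[mu]_(y in D) f y.
Proof.
move=> mf pf Dx; rewrite integralE [RHS]integralE.
have mp : measurable_fun setT f^\+ by exact: measurable_funepos.
have mn : measurable_fun setT f^\- by exact: measurable_funeneg.
have pp y : f^\+ (y + 2)%R = f^\+ y by rewrite !funeposE pf.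
have pn y : f^\- (y + 2)%R = f^\- y by rewrite !funenegE pf.
rewrite -(ge0_integral_domI_periodic mp (funepos_ge0 f) pp Dx).
rewrite -(ge0_integral_domI_periodic mn (funeneg_ge0 f) pn Dx).
by congr (_ - _); apply: eq_integral => y _; rewrite ?(funeposE, funenegE).
Qed.

Lemma integrable_domI_periodic (x : R) (f : R -> \bar R) :
  measurable_fun setT f -> (forall y, f (y + 2)%R = f y) -> D x ->
  mu.-integrable D f -> mu.-integrable D (fun y => f (x - y)%R).
Proof.
move=> mf pf Dx /integrableP[_ fi]; apply/integrableP; split.
  apply: (measurable_funTS (D := D)).
  by apply: (measurableT_comp mf); exact: measurable_reflect_at.
rewrite (@ge0_integral_domI_periodic _ (fun y => `|f y|))//.
  exact: measurableT_comp.
by move=> y; rewrite pf.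
Qed.

End Reflection.

(** * Measurability and complex integrals of 2-periodic functions *)

Section PeriodicIntegral.
Context {R : realType}.
Local Notation mu := (@lebesgue_measure R).
Local Notation D := (@domI R : set (measurableTypeR R)).

Lemma periodic_int (V : Type) (f : R -> V) : (forall y, f (y + 2) = f y) ->
  forall (k : int) y, f (y + 2 * k%:~R) = f y.
Proof.
move=> pf; have pn n y : f (y + 2 * n%:R) = f y.
  elim: n y => [|n ih] y; first by rewrite mulr0 addr0.
  by rewrite -(natr1 n) mulrDr mulr1 addrA pf ih.
case=> n y; first exact: pn.
by rewrite NegzE mulrNz -pmulrn mulrN -[LHS](pn n.+1) subrK.
Qed.

(** A preimage under [f] is the countable union of the translates by 2k of its part in [-1, 1[.
    Adding the endpoint -1 to [domI] does not affect measurability. *)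
Lemma measurable_periodic (f : R -> R) : (forall y, f (y + 2) = f y) ->
  measurable_fun D f -> measurable_fun setT f.
Proof.
move=> pf mf.
have mf' : measurable_fun (`[(-1)%R, 1%R[ : set R) f.
  by apply/measurable_fun_itv_obnd_cbndP.
move=> _ Y mY; rewrite setTI.
rewrite (_ : f @^-1` Y = \bigcup_(k : int)
    ((fun t : R => t - 2 * k%:~R) @^-1` (`[(-1)%R, 1%R[ `&` f @^-1` Y))); last first.
  apply/seteqP; split => [t /= ft|t [k _] /= [_]]; last first.
    by rewrite -mulrN -mulrNz periodic_int.
  (* This is the k for which t - 2k lies in [-1, 1[. *)
  exists (Num.floor ((t + 1) / 2)) => //=.
  have := floor_itv ((t + 1) / 2); set k := Num.floor _.
  rewrite intrD => /andP[k1 k2]; split; last by rewrite -mulrN -mulrNz periodic_int.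
  by rewrite in_itv/=; apply/andP; split; lra.
apply: countable_bigcupT_measurable => [|k]; first exact: countableP.
rewrite -[X in measurable X]setTI.
apply: (_ : measurable_fun setT (fun t : R => t - 2 * k%:~R)) => //.
- by apply: measurable_funB => //; exact: measurable_cst.
- exact: mf'.
Qed.

Lemma cmeasurable_periodic (F : R -> R[i]) : (forall y, F (y + 2) = F y) ->
  cmeasurable F -> measurable_fun setT (fun y => complex.Re (F y)) /\
    measurable_fun setT (fun y => complex.Im (F y)).
Proof.
by move=> pF [mr mi]; split; apply: measurable_periodic => //;
  move=> y; rewrite pF.
Qed.

Lemma cintegral_periodic (F : R -> R[i]) x : (forall y, F (y + 2) = F y) ->
  cmeasurable F -> D x -> cintegral D (fun y => F (x - y)) = cintegral D F.
Proof.
move=> pF mF Dx; have [mr mi] := cmeasurable_periodic pF mF.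
apply: complex_ext; rewrite /cintegral /Rintegral /=; congr fine.
  apply: (@integral_domI_periodic _ x (EFin \o (fun y => complex.Re (F y)))) => //.
    exact/measurable_EFinP.
  by move=> y /=; rewrite pF.
apply: (@integral_domI_periodic _ x (EFin \o (fun y => complex.Im (F y)))) => //.
  exact/measurable_EFinP.
by move=> y /=; rewrite pF.
Qed.

Lemma cmeasurable_periodic_reflect (F : R -> R[i]) x :
  (forall y, F (y + 2) = F y) -> cmeasurable F -> cmeasurable (fun y => F (x - y)).
Proof.
move=> pF mF; have [mr mi] := cmeasurable_periodic pF mF.
have mx := measurable_reflect_at x.
by split; apply: (measurable_funTS (D := D));
  [exact: (measurableT_comp mr mx)|exact: (measurableT_comp mi mx)].
Qed.

Lemma L2_periodic_reflect (F : R -> R[i]) x : (forall y, F (y + 2) = F y) ->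
  D x -> L2 F -> L2 (fun y => F (x - y)).
Proof.
move=> pF Dx /L2P[mF jF]; apply/L2P; split; first exact: cmeasurable_periodic_reflect.
have mf := measurable_sqr_normc mF.
apply: (@integrable_domI_periodic _ x (EFin \o (fun y => Normc.normc (F y) ^+ 2))) => //.
  by apply/measurable_EFinP; apply: measurable_periodic => // y; rewrite pF.
by move=> y /=; rewrite pF.
Qed.

End PeriodicIntegral.

(** * The Fourier basis *)

Section Fourier.
Context {R : realType}.
Local Notation mu := (@lebesgue_measure R).
Local Notation D := (@domI R : set (measurableTypeR R)).
Implicit Types (x y t : R) (k j : int).

Lemma expiD t y : expi (t + y) = expi t * expi y.
Proof. by apply: complex_ext; rewrite /expi/= ?cosD ?sinD; ring. Qed.

Lemma expiN t : expi (- t) = conjc (expi t).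
Proof. by rewrite /expi cosN sinN. Qed.

Lemma expi0 : expi 0 = 1 :> R[i].
Proof. by rewrite /expi cos0 sin0. Qed.

Lemma normc_expi t : Normc.normc (expi t) = 1.
Proof. by rewrite /expi/= cos2Dsin2 sqrtr1. Qed.

Lemma expi_2pi : expi (pi * 2) = 1 :> R[i].
Proof. by rewrite /expi mulr_natr cos2pi sin2pi. Qed.

Lemma expi_periodic k t : expi (pi * k%:~R * (t + 2)) = expi (pi * k%:~R * t).
Proof.
have p1 y : expi (pi * (y + 2)) = expi (pi * y).
  by rewrite mulrDr expiD expi_2pi mulr1.
by rewrite -!mulrA mulrDr (mulrC _ 2) (periodic_int p1).
Qed.

Lemma fourier_periodic k t : fourier k (t + 2) = fourier k t.
Proof. by rewrite /fourier expi_periodic. Qed.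

Lemma sqrt2_neq0 : (Num.sqrt 2 : R) != 0.
Proof. by rewrite gt_eqF// sqrtr_gt0. Qed.

Lemma fourierE k t : fourier k t = (Num.sqrt 2)^-1%:C * expi (pi * k%:~R * t).
Proof. by []. Qed.

Lemma fourierM j k t :
  fourier j t * fourier k t = (Num.sqrt 2)^-1%:C * fourier (j + k) t.
Proof.
by rewrite !fourierE intrD mulrDr mulrDl expiD; ring.
Qed.

Lemma fourierJ k t : conjc (fourier k t) = fourier (- k) t.
Proof.
rewrite /fourier mulrNz mulrN mulNr expiN.
by apply: complex_ext; rewrite ?(Re_conjc, Im_conjc, Re_mulc, Im_mulc)/=; ring.
Qed.

(** The product on the right carries the normalization 1/sqrt 2 twice, the left side once. This is
    the origin of the constant in front of the convolution integral. *)
Lemma fourier_sub k x t :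
  fourier k (x - t) = (Num.sqrt 2)%:C * (fourier k x * conjc (fourier k t)).
Proof.
rewrite fourierJ !fourierE mulrACA -expiD !mulrA -!rmorphM divff ?sqrt2_neq0//.
rewrite mul1r; congr (_ * expi _).
by rewrite mulrNz mulrBr mulrN mulNr.
Qed.

Lemma measurable_cosM (a : R) : measurable_fun setT (fun y : R => cos (a * y)).
Proof.
apply: measurableT_comp; last exact: measurable_funM.
by apply: continuous_measurable_fun; exact: continuous_cos.
Qed.

Lemma measurable_sinM (a : R) : measurable_fun setT (fun y : R => sin (a * y)).
Proof.
apply: measurableT_comp; last exact: measurable_funM.
by apply: continuous_measurable_fun; exact: continuous_sin.
Qed.

Lemma cmeasurable_expi (a : R) : cmeasurable (fun y => expi (a * y)).
Proof.
split; apply: (measurable_funTS (D := D)).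
  exact: (measurable_cosM a).
exact: (measurable_sinM a).
Qed.

Lemma normc_real (r : R) : Normc.normc r%:C = `|r|.
Proof. by rewrite /= expr0n addr0 sqrtr_sqr. Qed.

Lemma normc_fourier k t : Normc.normc (fourier k t) = (Num.sqrt 2)^-1.
Proof.
by rewrite Normc.normcM normc_expi mulr1 normc_real ger0_norm// invr_ge0 sqrtr_ge0.
Qed.

Lemma L2_fourier k : L2 (fourier k : R -> R[i]).
Proof.
apply: (@L2_bounded _ _ (Num.sqrt 2)^-1) => [|y _]; last by rewrite normc_fourier.
by apply: cmeasurableZ; exact: cmeasurable_expi.
Qed.

Lemma cintegrable_expi (a : R) : cintegrable D (fun y => expi (a * y)).
Proof.
apply: (cintegrable_le (h := cst 1) (cmeasurable_expi a)).
  exact: integrable_domI_cst.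
by move=> y _; rewrite normc_expi.
Qed.

(* Reflecting to x0 - y instead of - y, with x0 a quarter period, multiplies the
   integrand by i, while neither reflection changes its integral. *)
Lemma cintegral_expi k : k != 0 -> cintegral D (fun y => expi (pi * k%:~R * y)) = 0.
Proof.
move=> k0; set G := fun y => expi (pi * k%:~R * y).
have kR0 : k%:~R != 0 :> R by rewrite intr_eq0.
have G2 y : G (y + 2) = G y by exact: expi_periodic.
have mG : cmeasurable G by exact: cmeasurable_expi.
pose x0 : R := (2 * k%:~R)^-1.
have Dx0 : D x0.
  rewrite /D /domI /= in_itv/= -ltr_norml normfV normrM.
  have k1 : 1 <= `|k%:~R : R|.
    by rewrite -intr_norm -[1]/(1%:~R) ler_int -gtz0_ge1 normr_gt0.
  rewrite invf_lt1; last by rewrite mulr_gt0// normr_gt0.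
  by rewrite ger0_norm//; lra.
have D0 : D 0 by rewrite /D /domI /= in_itv/=; apply/andP; split; lra.
have e y : G (x0 - y) = 'i%C * G (0 - y).
  rewrite /G mulrBr expiD sub0r mulrN; congr (_ * _).
  rewrite (_ : _ * x0 = pi / 2); last by rewrite /x0; field.
  by rewrite /expi cos_pihalf sin_pihalf.
have i0 : cintegrable D (fun y => G (0 - y)).
  have := cintegrable_expi (- (pi * k%:~R)).
  by under eq_fun do rewrite mulNr -mulrN -sub0r.
have := cintegral_periodic G2 mG Dx0; under eq_fun do rewrite e.
rewrite cintegralZ// (cintegral_periodic G2 mG D0) => /eqP.
rewrite -subr_eq0 -{2}(mul1r (cintegral _ _)) -mulrBl mulf_eq0 => /orP[|/eqP//].
by rewrite eq_complex/= => /andP[]; rewrite subr0 oner_eq0.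
Qed.

Lemma cintegral1 : cintegral D (fun=> 1) = 2%:C.
Proof.
have mD : fine (mu D) = 2 by rewrite mu_domI.
have e r : Rintegral mu D (fun=> r) = r * 2.
  by rewrite (Rintegral_cst mu measurable_domI) mD.
by apply: complex_ext; rewrite /cintegral /= e ?mul0r ?mul1r.
Qed.

Lemma sqrt2V2 : ((Num.sqrt 2)^-1 * (Num.sqrt 2)^-1 : R) = 2^-1.
Proof. by rewrite -invfM -expr2 sqr_sqrtr. Qed.

(** The integrand is half the exponential of frequency k - j, whose integral is 0 unless j = k and 2
    otherwise. *)
Lemma braket_fourier j k : braket (fourier j) (fourier k) = (j == k)%:R :> R[i].
Proof.
rewrite /braket.
under eq_fun do rewrite fourierJ fourierM fourierE mulrA -rmorphM/= sqrt2V2.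
rewrite cintegralZ; last exact: cintegrable_expi.
have [->|jk] := eqVneq j k; last first.
  by rewrite cintegral_expi ?mulr0// addrC subr_eq0 eq_sym.
under eq_fun do rewrite addNr mulr0 mul0r expi0.
by rewrite cintegral1 -rmorphM/= mulVf// pnatr_eq0.
Qed.

End Fourier.

(** * Trigonometric polynomials and their L^2-closure *)

Section Trigpoly.
Context {R : realType}.
Local Notation D := (@domI R : set (measurableTypeR R)).

(** The linear span of the basis as an inductive predicate: properties stable under sums and scalars
    follow by induction, without handling coefficients. *)
Inductive trigpoly : (R -> R[i]) -> Prop :=
| trigpoly_fourier k : trigpoly (fourier k)
| trigpolyD f g : trigpoly f -> trigpoly g -> trigpoly (fun y => f y + g y)
| trigpolyZ c f : trigpoly f -> trigpoly (fun y => c * f y).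

Lemma L2_trigpoly f : trigpoly f -> L2 f.
Proof.
elim=> [k|{}f g _ hf _ hg|c {}f _ hf]; [exact: L2_fourier|exact: L2D|exact: L2Z].
Qed.

Lemma trigpolyM f g : trigpoly f -> trigpoly g -> trigpoly (fun y => f y * g y).
Proof.
move=> + hg; elim=> [j|{}f h _ hf _ hh|c {}f _ hf].
- elim: hg => [k|{}g h _ ihg _ ihh|c {}g _ ihg].
  + under eq_fun do rewrite fourierM.
    exact/trigpolyZ/trigpoly_fourier.
  + by under eq_fun do rewrite mulrDr; exact: trigpolyD.
  + by under eq_fun do rewrite mulrCA; exact: trigpolyZ.
- by under eq_fun do rewrite mulrDl; exact: trigpolyD.
- by under eq_fun do rewrite -mulrA; exact: trigpolyZ.
Qed.

Lemma trigpoly_cst (c : R[i]) : trigpoly (fun=> c).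
Proof.
have -> : (fun=> c) = (fun y => c * (Num.sqrt 2)%:C * fourier 0 y) :> (R -> R[i]).
  apply/funext => y; rewrite fourierE mulr0 mul0r expi0 mulr1 -mulrA -rmorphM/=.
  by rewrite divff ?sqrt2_neq0// mulr1.
exact/trigpolyZ/trigpoly_fourier.
Qed.

(** Real-valued trigonometric polynomials are kept as functions into [R], so that they can be
    compared by the order. *)
Definition real_trigpoly (p : R -> R) := trigpoly (fun y => (p y)%:C).

Lemma real_trigpoly_cst (r : R) : real_trigpoly (fun=> r).
Proof. exact: trigpoly_cst. Qed.

Lemma real_trigpolyD p q : real_trigpoly p -> real_trigpoly q ->
  real_trigpoly (fun y => p y + q y).
Proof.
by move=> hp hq; rewrite /real_trigpoly; under eq_fun do rewrite rmorphD;
  exact: trigpolyD.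
Qed.

Lemma real_trigpolyM p q : real_trigpoly p -> real_trigpoly q ->
  real_trigpoly (fun y => p y * q y).
Proof.
by move=> hp hq; rewrite /real_trigpoly; under eq_fun do rewrite rmorphM;
  exact: trigpolyM.
Qed.

Lemma real_trigpolyB p q : real_trigpoly p -> real_trigpoly q ->
  real_trigpoly (fun y => p y - q y).
Proof.
move=> hp hq; under eq_fun do rewrite -mulN1r.
by apply/real_trigpolyD => //; apply: real_trigpolyM => //; exact: real_trigpoly_cst.
Qed.

Lemma real_trigpolyX p n : real_trigpoly p -> real_trigpoly (fun y => p y ^+ n).
Proof.
move=> hp; elim: n => [|n ih]; first exact: real_trigpoly_cst.
by under eq_fun do rewrite exprS; exact: real_trigpolyM.
Qed.

(** Euler's formula for the sine, with frequencies 1 and -1. *)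
Lemma real_trigpoly_sin (a : R) : real_trigpoly (fun y => sin (pi * y - a)).
Proof.
(* The factor [s] undoes the normalization [t] of the basis, and 1/(2i) is written as -i/2. *)
pose s : R[i] := (Num.sqrt 2)%:C; pose t : R[i] := (Num.sqrt 2)^-1%:C.
pose c1 : R[i] := s * (- (2^-1)%:C * 'i%C * expi (- a)).
pose c2 : R[i] := s * ((2^-1)%:C * 'i%C * expi a).
rewrite /real_trigpoly (_ : (fun _ => _) =
    (fun y => c1 * fourier 1 y + c2 * fourier (-1) y)).
  by apply: trigpolyD; apply: trigpolyZ; exact: trigpoly_fourier.
apply/funext => y; rewrite -fourierJ fourierE -/t.
have st : s * t = 1 by rewrite /s /t -rmorphM/= divff ?sqrt2_neq0.
have tJ : conjc t = t by rewrite conjc_real.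
rewrite [conjc _](_ : _ = t * conjc (expi (pi * 1%:~R * y))); last first.
  by rewrite -tJ; apply: complex_ext; rewrite ?(Re_conjc, Im_conjc, Re_mulc, Im_mulc)/=; ring.
rewrite mulr1 /c1 /c2.
transitivity (s * t * (- (2^-1)%:C * 'i%C * expi (- a) * expi (pi * y) +
    (2^-1)%:C * 'i%C * expi a * conjc (expi (pi * y)))); last by ring.
rewrite st mul1r -expiN -!mulrA -!expiD.
rewrite (_ : a + - (pi * y) = - (pi * y - a)); last by ring.
rewrite (_ : - a + (pi * y) = (pi * y - a)); last by ring.
by rewrite expiN; apply: complex_ext; rewrite ?(Re_conjc, Im_conjc, Re_mulc, Im_mulc, Re_addc, Im_addc)/=; field.
Qed.

End Trigpoly.

(** * The L^2-closure of the trigonometric polynomials *)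

Section Density.
Context {R : realType}.
Local Notation mu := (@lebesgue_measure R).
Local Notation D := (@domI R : set (measurableTypeR R)).

(** Squared L^2 norm with extended values, so that estimates need measurability only; an infinite
    norm is not collapsed to 0 as by [fine] in [sqnorm]. *)
Definition esqnorm (f : R -> R[i]) : \bar R :=
  (\int[mu]_(y in D) (Normc.normc (f y) ^+ 2)%:E)%E.

Lemma measurable_EFin_sqr_normc f : cmeasurable f ->
  measurable_fun D (fun y : R => (Normc.normc (f y) ^+ 2)%:E).
Proof. by move=> mf; apply/measurable_EFinP; exact: measurable_sqr_normc. Qed.

Lemma esqnormD_le f g : cmeasurable f -> cmeasurable g ->
  (esqnorm (fun y => (f y + g y)%R) <= 2%:E * esqnorm f + 2%:E * esqnorm g)%E.
Proof.
move=> mf mg; have msf := measurable_EFin_sqr_normc mf.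
have msg := measurable_EFin_sqr_normc mg.
have sq0 (z : R[i]) : (0 <= (Normc.normc z ^+ 2)%:E)%E by rewrite lee_fin sqr_ge0.
have m2 : (0 <= 2%:E :> \bar R)%E by rewrite lee_fin.
rewrite /esqnorm -!ge0_integralZl//; try exact: measurable_domI.
rewrite -ge0_integralD//; try exact: measurable_domI; first last.
- exact: measurable_funeM.
- by move=> y _; rewrite mule_ge0.
- exact: measurable_funeM.
- by move=> y _; rewrite mule_ge0.
apply: ge0_le_integral => //; first exact: measurable_domI.
- by apply: measurable_EFin_sqr_normc; exact: cmeasurableD.
- by apply: emeasurable_funD; exact: measurable_funeM.
- by move=> y _; rewrite -!EFinM -EFinD lee_fin; exact: sqr_normcD_le.
Qed.

Lemma esqnormZ c f : cmeasurable f ->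
  esqnorm (fun y => c * f y) = ((Normc.normc c ^+ 2)%:E * esqnorm f)%E.
Proof.
move=> mf; rewrite /esqnorm -ge0_integralZl//.
- by apply: eq_integral => y _; rewrite Normc.normcM exprMn EFinM.
- exact: measurable_domI.
- exact: measurable_EFin_sqr_normc.
- by move=> y _; rewrite lee_fin sqr_ge0.
- by rewrite lee_fin sqr_ge0.
Qed.

Definition approximable (f : R -> R[i]) := cmeasurable f /\
  forall e : R, 0 < e ->
    exists2 p, trigpoly p & (esqnorm (fun y => f y - p y)%R < e%:E)%E.

Lemma approximable_limit f : cmeasurable f ->
  (forall e : R, 0 < e ->
    exists2 g, approximable g & (esqnorm (fun y => f y - g y)%R < e%:E)%E) ->
  approximable f.
Proof.
(* Two errors below e/4, each doubled by [esqnormD_le], add up to less than e. *)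
move=> mf fg; split=> // e e0; have e4 : 0 < e / 4 by rewrite divr_gt0.
have [g [mg ag] hg] := fg _ e4; have [p tp hp] := ag _ e4; exists p => //.
have mp := L2_cmeasurable (L2_trigpoly tp).
have := esqnormD_le (cmeasurableB mf mg) (cmeasurableB mg mp).
under [in X in (X <= _)%E -> _]eq_fun do rewrite addrA subrK.
move=> /le_lt_trans; apply.
rewrite [X in (_ < X)%E](_ : _ = (2%:E * (e / 4)%:E + 2%:E * (e / 4)%:E)%E); last first.
  by rewrite -!EFinM -EFinD; congr EFin; field.
by rewrite lteD// lte_pmul2l// lte_fin.
Qed.

Lemma esqnorm0 : esqnorm (fun=> 0) = 0%E.
Proof.
by rewrite /esqnorm; under eq_integral do rewrite Normc.normc0 expr0n/=; exact: integral0.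
Qed.

Lemma approximable_trigpoly p : trigpoly p -> approximable p.
Proof.
move=> tp; split; first exact/L2_cmeasurable/L2_trigpoly.
move=> e e0; exists p => //; under eq_fun do rewrite subrr.
by rewrite esqnorm0 lte_fin.
Qed.

Lemma approximableD f g : approximable f -> approximable g ->
  approximable (fun y => f y + g y).
Proof.
move=> [mf af] [mg ag]; split; first exact: cmeasurableD.
move=> e e0; have e4 : 0 < e / 4 by rewrite divr_gt0.
have [p tp hp] := af _ e4; have [q tq hq] := ag _ e4.
exists (fun y => p y + q y); first exact: trigpolyD.
have mp := L2_cmeasurable (L2_trigpoly tp).
have mq := L2_cmeasurable (L2_trigpoly tq).
under eq_fun do rewrite opprD addrACA.
apply: (le_lt_trans (esqnormD_le (cmeasurableB mf mp) (cmeasurableB mg mq))).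
rewrite [X in (_ < X)%E](_ : _ = (2%:E * (e / 4)%:E + 2%:E * (e / 4)%:E)%E); last first.
  by rewrite -!EFinM -EFinD; congr EFin; field.
by rewrite lteD// lte_pmul2l// lte_fin.
Qed.

Lemma approximableZ c f : approximable f -> approximable (fun y => c * f y).
Proof.
move=> [mf af]; split; first exact: cmeasurableZ.
(* Adding 1 keeps the divisor positive when [c] is 0. *)
move=> e e0; have c0 : 0 < Normc.normc c ^+ 2 + 1.
  by rewrite ltr_wpDl// sqr_ge0.
have [p tp hp] := af _ (divr_gt0 e0 c0).
exists (fun y => c * p y); first exact: trigpolyZ.
have mp := L2_cmeasurable (L2_trigpoly tp).
under eq_fun do rewrite -mulrBr.
rewrite esqnormZ; last exact: cmeasurableB.
apply: (@le_lt_trans _ _ ((Normc.normc c ^+ 2 + 1)%:E * esqnorm (fun y => f y - p y)%R)%E).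
  apply: lee_wpmul2r; last by rewrite lee_fin lerDl.
  by apply: integral_ge0 => y _; rewrite lee_fin sqr_ge0.
rewrite (_ : e = (Normc.normc c ^+ 2 + 1) * (e / (Normc.normc c ^+ 2 + 1))).
  by rewrite EFinM lte_pmul2l// lte_fin.
by field; rewrite gt_eqF.
Qed.

Lemma approximableB f g : approximable f -> approximable g ->
  approximable (fun y => f y - g y).
Proof.
move=> hf hg; under eq_fun do rewrite -mulN1r.
by apply: approximableD => //; exact: approximableZ.
Qed.

Lemma approximable_sum (I : Type) (s : seq I) (F : I -> R -> R[i]) :
  (forall i, approximable (F i)) -> approximable (fun y => \sum_(i <- s) F i y).
Proof.
move=> aF; elim: s => [|i s ih].
  by under eq_fun do rewrite big_nil; exact/approximable_trigpoly/trigpoly_cst.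
by under eq_fun do rewrite big_cons; exact: approximableD.
Qed.

(** Dominated convergence is applied to the squared differences, which tend to 0 almost everywhere
    below [H]. The almost-everywhere form leaves room for the jump of a ray's indicator. *)
Lemma approximable_dominated (f H : R -> R) (f_ : nat -> R -> R) :
  measurable_fun D f -> mu.-integrable D (EFin \o H) ->
  (forall n, approximable (fun y => (f_ n y)%:C)) ->
  (forall n y, D y -> (f y - f_ n y) ^+ 2 <= H y) ->
  {ae mu, forall y, D y -> f_ ^~ y @ \oo --> f y} ->
  approximable (fun y => (f y)%:C).
Proof.
move=> mf iH af bf cf.
have mf_ n : measurable_fun D (f_ n) by have [[]] := af n.
have e2 n y : Normc.normc ((f y)%:C - (f_ n y)%:C) ^+ 2 = (f y - f_ n y) ^+ 2.
  by rewrite -rmorphB normc_real real_normK// num_real.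
have mg n : measurable_fun D (fun y => ((f y - f_ n y) ^+ 2)%:E).
  by apply/measurable_EFinP; apply: measurable_funX; exact: measurable_funB.
have [|||_ _] := @dominated_convergence _ _ _ mu D measurable_domI
    (fun n y => ((f y - f_ n y) ^+ 2)%:E) (cst 0%E) (EFin \o H) mg _ _ iH.
- exact: measurable_cst.
- apply: filterS cf => y + Dy => /(_ Dy) cfy.
  apply: cvg_EFin; first exact: nearW.
  rewrite (_ : _ \o _ = fun n => (f y - f_ n y) ^+ 2)//.
  have c0 : (fun n => f y - f_ n y) @ \oo --> (0 : R).
    by rewrite -(subrr (f y)); apply: cvgB => //; exact: cvg_cst.
  by rewrite -(mulr0 (0 : R)); apply: cvgM.
- apply: aeW => y n Dy; rewrite /= lee_fin ger0_norm ?sqr_ge0//.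
  exact: bf.
(* Convergence to a finite limit makes the integrals eventually finite, so that a bound on their
   [fine] values is a bound on [esqnorm]. *)
rewrite integral0 => /fine_cvgP[fin /cvgrPdist_lt c0].
apply: approximable_limit; first exact: cmeasurable_real.
move=> e e0; have [n _ /(_ n (leqnn n))[]] := filterI fin (c0 _ e0) => fn /=.
rewrite sub0r normrN => ltn; exists (fun y => (f_ n y)%:C) => //.
rewrite /esqnorm; under eq_integral do rewrite e2.
have fn' : (\int[mu]_(y in D) ((f y - f_ n y) ^+ 2)%:E)%E \is a fin_num by exact: fn.
by rewrite -(fineK fn') lte_fin (le_lt_trans (ler_norm _) ltn).
Qed.

End Density.

(** * Polynomials approximating a step at 1/2 *)

Section StepPolynomials.
Context {R : realType}.

Lemma bernoulli_ineq (t : R) m : -1 <= t -> 1 + m%:R * t <= (1 + t) ^+ m.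
Proof.
move=> t1; elim: m => [|m ih]; first by rewrite mul0r addr0 expr0.
rewrite exprSr; apply: (@le_trans _ _ ((1 + m%:R * t) * (1 + t))).
  have : 0 <= m%:R * t ^+ 2 by rewrite mulr_ge0// sqr_ge0.
  rewrite -(natr1 m); move: (m%:R : R) => r; nra.
by rewrite ler_wpM2r//; lra.
Qed.

(** The exponent 2^n places the threshold at 1/2: the value is governed by 2^n q^n = (2q)^n. *)
Definition step_poly (n : nat) (q : R) : R := (1 - q ^+ n) ^+ (2 ^ n).

Lemma step_poly_ge0 n q : 0 <= q <= 1 -> 0 <= step_poly n q.
Proof. by move=> /andP[q0 q1]; rewrite exprn_ge0// subr_ge0 exprn_ile1. Qed.

Lemma step_poly_le1 n q : 0 <= q <= 1 -> step_poly n q <= 1.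
Proof.
move=> /andP[q0 q1]; rewrite exprn_ile1// ?subr_ge0 ?exprn_ile1//.
by rewrite gerBl exprn_ge0.
Qed.

(** Bernoulli's inequality with t = - q^n and exponent 2^n. *)
Lemma step_poly_ge n q : 0 <= q <= 1 -> 1 - (2 * q) ^+ n <= step_poly n q.
Proof.
move=> /andP[q0 q1]; apply: le_trans (@bernoulli_ineq (- q ^+ n) (2 ^ n) _).
  by rewrite mulrN natrX exprMn.
by rewrite lerN2 exprn_ile1.
Qed.

(** Multiplying by (1 + q^n)^(2^n) gives (1 - q^(2n))^(2^n), at most 1, while Bernoulli's inequality
    bounds the multiplier below by (2q)^n. *)
Lemma step_poly_le n q : 0 < q <= 1 -> step_poly n q <= (2 * q)^-1 ^+ n.
Proof.
move=> /andP[q0 q1]; have qn0 : 0 <= q ^+ n by rewrite exprn_ge0// ltW.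
have qn1 : q ^+ n <= 1 by rewrite exprn_ile1// ltW.
have w0 : 0 < (2 * q) ^+ n by rewrite exprn_gt0// mulr_gt0.
rewrite exprVn -[leLHS]mul1r -[leRHS]mulr1 mulrC ler_pdivlMl//.
have h : (2 * q) ^+ n <= (1 + q ^+ n) ^+ (2 ^ n).
  apply: le_trans (@bernoulli_ineq (q ^+ n) (2 ^ n) _); last by lra.
  by rewrite natrX -exprMn lerDr.
apply: (@le_trans _ _ ((1 + q ^+ n) ^+ (2 ^ n) * step_poly n q)).
  by rewrite mulr1 ler_wpM2r// step_poly_ge0// q1 ltW.
rewrite /step_poly -exprMn [X in X ^+ _](_ : _ = 1 - (q ^+ n) ^+ 2); last by ring.
by rewrite exprn_ile1// ?subr_ge0 ?gerBl ?sqr_ge0// exprn_ile1.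
Qed.

Lemma cvg_geometric_bound (u : nat -> R) (l z : R) : 0 <= z < 1 ->
  (forall n, `|l - u n| <= z ^+ n) -> u @ \oo --> l.
Proof.
move=> /andP[z0 z1] ub.
have cz : (fun n => z ^+ n) @ \oo --> (0 : R) by apply: cvg_expr; rewrite ger0_norm.
apply/cvgrPdist_lt => e e0; move/cvgrPdist_lt : cz => /(_ _ e0).
apply: filterS => n; rewrite sub0r normrN => zn.
by rewrite (le_lt_trans (ub n))// (le_lt_trans (ler_norm _)).
Qed.

Lemma cvg_step_poly1 q : 0 <= q < 2^-1 -> (fun n => step_poly n q) @ \oo --> (1 : R).
Proof.
move=> /andP[q0 q1]; have q01 : 0 <= q <= 1 by apply/andP; split => //; lra.
apply: (@cvg_geometric_bound _ _ (2 * q)) => [|n]; first by apply/andP; split; lra.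
rewrite ger0_norm ?subr_ge0 ?step_poly_le1//.
by have := step_poly_ge n q01; lra.
Qed.

Lemma cvg_step_poly0 q : 2^-1 < q <= 1 -> (fun n => step_poly n q) @ \oo --> (0 : R).
Proof.
move=> /andP[q0 q1]; have q01 : 0 <= q <= 1 by apply/andP; split => //; lra.
apply: (@cvg_geometric_bound _ _ (2 * q)^-1) => [|n].
  by rewrite invr_ge0 invf_lt1; [apply/andP; split; lra|lra].
rewrite sub0r normrN ger0_norm ?step_poly_ge0//.
by apply: step_poly_le; apply/andP; split => //; lra.
Qed.

End StepPolynomials.

(** * Density: from rays to measurable sets, simple functions and L^2 *)

Section DensityL2.
Context {R : realType}.
Local Notation mu := (@lebesgue_measure R).
Local Notation D := (@domI R : set (measurableTypeR R)).

(** This form shows a trigonometric polynomial of period 2, and the divisor 4 keeps its values in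
    [0, 1]. The position relative to 1/2 is read off the product form [ray_gaugeE]. *)
Definition ray_gauge (a y : R) : R :=
  2^-1 - (sin (pi * y - pi * a / 2) - sin (pi * a / 2)) / 4.

(** Product-to-sum formula. On [domI] the cosine is positive, so the sign of y - a decides on which
    side of 1/2 the gauge lies. *)
Lemma ray_gaugeE a y :
  ray_gauge a y = 2^-1 - sin (pi * (y - a) / 2) * cos (pi * y / 2) / 2.
Proof.
rewrite /ray_gauge; set A := pi * (y - a) / 2; set B := pi * y / 2.
rewrite (_ : pi * y - pi * a / 2 = A + B); last by rewrite /A /B; field.
rewrite (_ : pi * a / 2 = - (A - B)); last by rewrite /A /B; field.
by rewrite sinN sinD sinB; field.
Qed.

Lemma ray_gauge01 a y : 0 <= ray_gauge a y <= 1.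
Proof.
have := (sin_le1 (pi * y - pi * a / 2), sin_geN1 (pi * y - pi * a / 2)).
have := (sin_le1 (pi * a / 2), sin_geN1 (pi * a / 2)).
rewrite /ray_gauge; move: (sin _) (sin _) => s t [? ?] [? ?].
by apply/andP; split; lra.
Qed.

Lemma cos_domI_gt0 y : D y -> 0 < cos (pi * y / 2).
Proof.
rewrite /domI /= in_itv/= => /andP[y1 y2]; apply: cos_gt0_pihalf.
have p0 := pi_gt0 R; apply/andP; split.
  by rewrite -mulNr ltr_pM2r// -[ltLHS]mulr1 mulNr -mulrN ltr_pM2l.
by rewrite ltr_pM2r// -[ltRHS]mulr1 ltr_pM2l.
Qed.

Lemma ray_gauge_lt a y : -1 < a -> D y -> a < y -> ray_gauge a y < 2^-1.
Proof.
move=> a1 Dy ay; rewrite ray_gaugeE gtrBl divr_gt0//.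
rewrite mulr_gt0 ?cos_domI_gt0// sin_gt0_pi//.
have p0 := pi_gt0 R; move: Dy; rewrite /domI /= in_itv/= => /andP[_ y1].
apply/andP; split; first by rewrite divr_gt0// mulr_gt0// subr_gt0.
(* Since a > -1 and y < 1, the difference y - a is below 2 and the argument of the sine stays below
   pi. *)
by rewrite -mulrA -[ltRHS]mulr1 ltr_pM2l//; lra.
Qed.

Lemma ray_gauge_gt a y : a < 1 -> D y -> y < a -> 2^-1 < ray_gauge a y.
Proof.
move=> a1 Dy ya; rewrite ray_gaugeE ltrDl -mulNr divr_gt0// -mulNr -sinN.
rewrite mulr_gt0 ?cos_domI_gt0// sin_gt0_pi//.
have p0 := pi_gt0 R; move: Dy; rewrite /domI /= in_itv/= => /andP[y1 _].
rewrite -mulNr -mulrN opprB.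
apply/andP; split; first by rewrite divr_gt0// mulr_gt0// subr_gt0.
by rewrite -mulrA -[ltRHS]mulr1 ltr_pM2l//; lra.
Qed.

Lemma real_trigpoly_step a n : real_trigpoly (fun y => step_poly n (ray_gauge a y)).
Proof.
have c := @real_trigpoly_cst R.
apply: real_trigpolyX; apply: real_trigpolyB => //; apply: real_trigpolyX.
apply: real_trigpolyB => //; apply: real_trigpolyM => //.
by apply: real_trigpolyB => //; exact: real_trigpoly_sin.
Qed.

Definition approximable_set (A : set (measurableTypeR R)) :=
  approximable (fun y => (\1_A y : R)%:C).

Lemma eq_approximable (f g : R -> R[i]) : (forall y, D y -> f y = g y) ->
  cmeasurable g -> approximable f -> approximable g.
Proof.
move=> fg mg [mf af]; split=> // e /af[p tp hp]; exists p => //.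
rewrite (_ : esqnorm _ = esqnorm (fun y => f y - p y)%R)//.
by apply: eq_integral => y /set_mem Dy; rewrite fg.
Qed.

Lemma measurable_indicD (A : set (measurableTypeR R)) : measurable A ->
  measurable_fun D (\1_A : _ -> R).
Proof. by move=> mA; exact: measurable_indic. Qed.

Lemma indic01 (A : set (measurableTypeR R)) y : 0 <= (\1_A y : R) <= 1.
Proof. by rewrite indicE; case: (_ \in _); rewrite /= ?lexx ler01. Qed.

Lemma sqr_sub_le1 (s t : R) : 0 <= s <= 1 -> 0 <= t <= 1 -> (s - t) ^+ 2 <= 1.
Proof. move=> /andP[? ?] /andP[? ?]; nra. Qed.

Lemma approximable_cst (c : R[i]) : approximable (fun=> c).
Proof. exact/approximable_trigpoly/trigpoly_cst. Qed.

Lemma approximable_ray (a : R) : approximable_set `]a, +oo[%classic.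
Proof.
set A : set (measurableTypeR R) := `]a, +oo[%classic.
have mA : measurable A by exact: measurable_itv.
have mI := cmeasurable_real (measurable_indicD mA).
(* For [a] outside [domI] the indicator is constant on [domI]; the gauge is used only for -1 < a <
   1. *)
have [a1|a1] := leP a (-1).
  apply: (@eq_approximable (cst 1)) => // [y|]; last exact: approximable_cst.
  rewrite /domI /= in_itv/= => /andP[y1 y2].
  by rewrite indicE mem_set// /A /= in_itv/= andbT (le_lt_trans a1).
have [a2|a2] := leP 1 a.
  apply: (@eq_approximable (cst 0)) => // [y|]; last exact: approximable_cst.
  rewrite /domI /= in_itv/= => /andP[y1 y2].
  rewrite indicE memNset// /A /= in_itv/= andbT => ay.
  by have := lt_trans y2 (le_lt_trans a2 ay); rewrite ltxx.
apply: (@approximable_dominated _ _ (cst 1) (fun n y => step_poly n (ray_gauge a y))).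
- exact: measurable_indicD.
- exact: integrable_domI_cst.
- by move=> n; apply: approximable_trigpoly; exact: real_trigpoly_step.
- move=> n y Dy; apply: sqr_sub_le1; first exact: indic01.
  by rewrite step_poly_ge0 ?step_poly_le1 ?ray_gauge01.
(* The exceptional null set is the point [a], where the gauge takes the threshold value 1/2. *)
exists [set a]; split; [exact: measurable_set1|exact: lebesgue_measure_set1|].
move=> y; apply: contra_notP => /eqP ya Dy; rewrite indicE.
have := ray_gauge01 a y => /andP[g0 g1].
have [ay|ay] := ltP a y.
  rewrite mem_set; last by rewrite /A /= in_itv/= ay.
  by apply: cvg_step_poly1; rewrite g0 ray_gauge_lt.
rewrite memNset; last by rewrite /A /= in_itv/= andbT ltNge ay.
by apply: cvg_step_poly0; rewrite g1 ray_gauge_gt// lt_neqAle ya.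
Qed.

Lemma approximable_setC A : measurable A ->
  approximable_set A -> approximable_set (~` A).
Proof.
move=> mA aA; rewrite /approximable_set.
rewrite (_ : (fun _ => _) = (fun y => 1 - (\1_A y : R)%:C)).
  by apply: approximableB => //; exact: approximable_cst.
apply/funext => y; rewrite !indicE in_setC.
by case: (y \in A); apply: complex_ext; rewrite /= ?subrr ?subr0.
Qed.

(** Disjointness makes the indicator of a finite partial union the sum of the indicators; at each
    point these are eventually constant in n. *)
Lemma approximable_trivIset_bigcup (F : nat -> set (measurableTypeR R)) :
  (forall n, measurable (F n)) -> trivIset setT F ->
  (forall n, approximable_set (F n)) -> approximable_set (\bigcup_k F k).
Proof.
move=> mF tF aF.
have mU : measurable (\bigcup_k F k) by exact: bigcup_measurable.
have mUn n : measurable (\big[setU/set0]_(i < n) F i) by exact: bigsetU_measurable.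
apply: (@approximable_dominated _ _ (cst 1)
  (fun n y => \1_(\big[setU/set0]_(i < n) F i) y)).
- exact: measurable_indicD.
- exact: integrable_domI_cst.
- elim=> [|n ih].
    rewrite (_ : (fun _ => _) = cst 0); first exact: approximable_cst.
    by apply/funext => y; rewrite big_ord0 indic0.
  rewrite (_ : (fun _ => _) =
    (fun y => (\1_(\big[setU/set0]_(i < n) F i) y)%:C + (\1_(F n) y : R)%:C)).
    exact: (approximableD ih (aF n)).
  apply/funext => y; rewrite -rmorphD; congr (_%:C).
  rewrite big_ord_recr /= !indicE in_setU.
  have [yn|] := boolP (y \in F n); last by rewrite orbF addr0.
  rewrite orbT (_ : (y \in _) = false) ?add0r//.
  apply/negP => /set_mem; rewrite -bigcup_mkord => -[i /= ilt yi].
  have /(tF i n Logic.I Logic.I) e : F i `&` F n !=set0 by exists y; split => //; exact: set_mem.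
  by move: ilt; rewrite e ltnn.
- by move=> n y _; apply: sqr_sub_le1; exact: indic01.
apply: aeW => y Dy; rewrite indicE.
have [/set_mem[k _ Fky]|yU] := boolP (y \in \bigcup_k F k).
  apply: cvg_near_cst; exists k.+1 => // n /= kn; rewrite indicE mem_set//.
  by rewrite -bigcup_mkord; exists k.
apply: cvg_near_cst; apply: nearW => n; rewrite indicE memNset//.
rewrite -bigcup_mkord => -[k /= _ Fky]; move/negP: yU; apply.
by apply: mem_set; exists k.
Qed.

(** The open rays to the right generate the Borel sets and are stable under intersection, as
    Dynkin's theorem requires. *)
Lemma approximable_measurable (A : set (measurableTypeR R)) :
  measurable A -> approximable_set A.
Proof.
have E : @measurable _ (measurableTypeR R) = <<s @RGenOInfty.G R >>.
  exact: RGenOInfty.measurableE.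
move=> mA; apply: (dynkin_induction E) => //.
- move=> _ _ [a ->] [b ->]; exists (Num.max a b).
  by apply/seteqP; split => y /=; rewrite !in_itv/= !andbT gt_max; [case=> -> ->|case/andP].
- rewrite /approximable_set (_ : (fun _ => _) = cst 1); first exact: approximable_cst.
  by apply/funext => y; rewrite indicT.
- by move=> _ [a ->]; exact: approximable_ray.
- exact: approximable_setC.
- exact: approximable_trivIset_bigcup.
- by rewrite -E.
Qed.

Import HBNNSimple.

Lemma approximable_nnsfun (f : {nnsfun measurableTypeR R >-> R}) :
  approximable (fun y => (f y)%:C).
Proof.
rewrite (_ : (fun _ => _) = (fun y => \sum_(r <- finmap.enum_fset (fset_set (range f)))
    r%:C * (\1_(f @^-1` [set r]) y : R)%:C)).
  apply: approximable_sum => r; apply: approximableZ.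
  exact: approximable_measurable.
apply/funext => y; rewrite fimfunE fsbig_finite// rmorph_sum.
by apply: eq_bigr => r _; rewrite rmorphM.
Qed.

(** Simple functions f_n increasing to f satisfy 0 <= f_n <= f on [domI], so f^2 dominates (f -
    f_n)^2. *)
Lemma approximable_nonneg (f : R -> R) : measurable_fun D f -> (forall y, 0 <= f y) ->
  mu.-integrable D (EFin \o (fun y => f y ^+ 2)) -> approximable (fun y => (f y)%:C).
Proof.
move=> mf f0 jf; have mEf : measurable_fun D (EFin \o f) by exact/measurable_EFinP.
have f0' y : D y -> (0 <= (EFin \o f) y)%E by rewrite /= lee_fin f0.
pose f_ n : measurableTypeR R -> R := nnsfun_approx measurable_domI mEf n.
apply: (@approximable_dominated _ _ _ f_ mf jf).
- by move=> n; exact: approximable_nnsfun.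
- move=> n y Dy; have h0 : 0 <= f_ n y by exact: fun_ge0.
  have : f_ n y <= f y.
    by rewrite -lee_fin /f_ nnsfun_approxE; exact: le_approx f0' Dy.
  by move: (f_ n y) (f y) (f0 y) h0 => s t *; nra.
apply: aeW => y Dy.
by have /fine_cvgP[_] := cvg_nnsfun_approx measurable_domI mEf f0' Dy.
Qed.

Lemma approximable_real (f : R -> R) : measurable_fun D f ->
  mu.-integrable D (EFin \o (fun y => f y ^+ 2)) -> approximable (fun y => (f y)%:C).
Proof.
move=> mf jf.
have mn : measurable_fun D (fun y => `|f y|) by exact: measurableT_comp.
(* The signs s = 1 and s = -1 give the positive and negative parts together; the square of each is
   at most f^2. *)
have ap (s : R) : `|s| = 1 -> approximable (fun y => ((`|f y| + s * f y) / 2)%:C).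
  move=> s1; apply: approximable_nonneg.
  - by apply: measurable_funM => //; apply: measurable_funD => //; apply: measurable_funM.
  - move=> y; rewrite divr_ge0//.
    have := ler_norm (- (s * f y)); rewrite normrN normrM s1 mul1r; lra.
  - apply: (le_integrable measurable_domI _ _ jf).
      apply/measurable_EFinP; apply: measurable_funX.
      by apply: measurable_funM => //; apply: measurable_funD => //; apply: measurable_funM.
    move=> y Dy; rewrite /= lee_fin !(ger0_norm (sqr_ge0 _)).
    have a2 : `|f y| ^+ 2 = f y ^+ 2 by rewrite real_normK// num_real.
    have w2 : (s * f y) ^+ 2 = f y ^+ 2.
      by rewrite exprMn -(real_normK (num_real s)) s1 expr1n mul1r.
    have := sqr_ge0 (`|f y| - s * f y); move: a2 w2.
    by move: (s * f y) `|f y| (f y) => w a t; nra.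
rewrite (_ : (fun y => (f y)%:C) =
  (fun y => ((`|f y| + 1 * f y) / 2)%:C - ((`|f y| + -1 * f y) / 2)%:C)).
  by apply: approximableB; apply: ap; rewrite ?normrN normr1.
by apply/funext => y; rewrite -rmorphB; congr (_%:C); field.
Qed.

Lemma approximable_L2 (f : R -> R[i]) : L2 f -> approximable f.
Proof.
move=> /L2P[[mr mi] jf].
have jr : mu.-integrable D (EFin \o (fun y => complex.Re (f y) ^+ 2)).
  apply: (le_integrable measurable_domI _ _ jf).
    by apply/measurable_EFinP; exact: measurable_funX.
  move=> y _; rewrite /= lee_fin !ger0_norm ?sqr_ge0// sqr_normc lerDl sqr_ge0//.
have ji : mu.-integrable D (EFin \o (fun y => complex.Im (f y) ^+ 2)).
  apply: (le_integrable measurable_domI _ _ jf).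
    by apply/measurable_EFinP; exact: measurable_funX.
  move=> y _; rewrite /= lee_fin !ger0_norm ?sqr_ge0// sqr_normc lerDr sqr_ge0//.
rewrite (_ : f = (fun y => (complex.Re (f y))%:C + 'i%C * (complex.Im (f y))%:C)).
  by apply: approximableD; [|apply: approximableZ]; exact: approximable_real.
by apply/funext => y; exact: complexE.
Qed.

End DensityL2.

(** * Bessel's inequality and Parseval's identity *)

Section Parseval.
Context {R : realType}.
Local Notation mu := (@lebesgue_measure R).
Local Notation D := (@domI R : set (measurableTypeR R)).
Implicit Types (f g : R -> R[i]) (s : seq int).

Lemma mulcJ_normc (z : R[i]) : conjc z * z = (Normc.normc z ^+ 2)%:C.
Proof.
apply: complex_ext; first by rewrite Re_mulc Re_conjc Im_conjc [RHS]sqr_normc; ring.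
by rewrite Im_mulc Re_conjc Im_conjc [RHS]/=; ring.
Qed.

(** Pythagoras: expand the pairing of f - c e_k with itself; the three terms containing [c] each
    contribute |c|^2 up to sign. *)
Lemma sqnorm_sub_proj f k : L2 f -> let c := braket (fourier k) f in
  sqnorm (fun y => f y - c * fourier k y) = sqnorm f - Normc.normc c ^+ 2.
Proof.
move=> hf c; have hk := @L2_fourier R k; have hck := L2Z c hk.
apply: (@complexI R).
transitivity (braket f f - conjc c * c); last by rewrite mulcJ_normc braket_diag rmorphB.
rewrite -braket_diag.
have ef : braket f (fourier k) = conjc c by rewrite -braketJ.
have e1 : braket f (fun y => c * fourier k y) = conjc c * c.
  by rewrite braketZr// ef mulrC.
have e2 : braket (fun y => c * fourier k y) f = conjc c * c by rewrite braketZl.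
have e3 : braket (fun y => c * fourier k y) (fun y => c * fourier k y) = conjc c * c.
  by rewrite braketZl// braketZr// braket_fourier eqxx mulr1.
rewrite braketBl//; last exact: L2B.
by rewrite !braketBr// e1 e2 e3; ring.
Qed.

(** Induction on [s] for all [f] at once: removing the component along e_k lowers the squared norm
    by |<e_k|f>|^2 and, by orthogonality, keeps the other coefficients. *)
Lemma bessel s f : uniq s -> L2 f ->
  \sum_(k <- s) Normc.normc (braket (fourier k) f) ^+ 2 <= sqnorm f.
Proof.
elim: s f => [|k s ih] f /=; first by rewrite big_nil sqnorm_ge0.
move=> /andP[ks us] hf; have hk := @L2_fourier R k.
rewrite big_cons -lerBrDl -(sqnorm_sub_proj k hf).
have hg : L2 (fun y => f y - braket (fourier k) f * fourier k y).
  by apply: L2B => //; exact: L2Z.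
rewrite (le_trans _ (ih _ us hg))//; rewrite le_eqVlt; apply/orP; left; apply/eqP; apply: eq_big_seq => j js.
suff -> : braket (fourier j) (fun y => f y - braket (fourier k) f * fourier k y) =
    braket (fourier j) f by [].
have hj := @L2_fourier R j.
rewrite braketBr//; last exact: L2Z.
rewrite braketZr// braket_fourier (_ : (j == k) = false) ?mulr0 ?subr0//.
by apply/eqP => jk; move: ks; rewrite -jk js.
Qed.

(** Being conjugate-linear in [f], it can be treated separately on a trigonometric polynomial and on
    a small remainder. *)
Definition parseval_defect s f g : R[i] :=
  braket f g - \sum_(k <- s) conjc (braket (fourier k) f) * braket (fourier k) g.

Lemma parseval_defectD s f1 f2 g : L2 f1 -> L2 f2 -> L2 g ->
  parseval_defect s (fun y => f1 y + f2 y) g =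
  parseval_defect s f1 g + parseval_defect s f2 g.
Proof.
move=> h1 h2 hg; rewrite /parseval_defect braketDl// addrACA -opprD -big_split.
congr (_ - _); apply: eq_bigr => k _.
rewrite braketDr//; last exact: L2_fourier.
by rewrite rmorphD mulrDl.
Qed.

Lemma parseval_defectZ s c f g : L2 f -> L2 g ->
  parseval_defect s (fun y => c * f y) g = conjc c * parseval_defect s f g.
Proof.
move=> hf hg; rewrite /parseval_defect braketZl// mulrBr mulr_sumr.
congr (_ - _); apply: eq_bigr => k _.
rewrite braketZr//; last exact: L2_fourier.
by rewrite rmorphM mulrA.
Qed.

(** [s0] lists the frequencies of [p]; once [s] contains them, orthonormality makes the finite sum
    exact. *)
Lemma parseval_defect_trigpoly p g : trigpoly p -> L2 g ->
  exists s0, forall s, uniq s -> {subset s0 <= s} -> parseval_defect s p g = 0.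
Proof.
move=> tp hg; elim: tp => [j|f1 f2 t1 [s1 h1] t2 [s2 h2]|c f tf [s0 h0]].
- exists [:: j] => s us sub; have js : j \in s by apply: sub; rewrite mem_head.
  rewrite /parseval_defect (bigD1_seq j)// braket_fourier eqxx.
  rewrite [conjc 1]rmorph1 mul1r big1 => [|k kj]; first by rewrite [X in _ - X]addr0 subrr.
  by rewrite braket_fourier (negbTE kj) [conjc _]rmorph0 mul0r.
- exists (s1 ++ s2) => s us sub.
  rewrite parseval_defectD//; try exact: L2_trigpoly.
  rewrite h1// ?h2// ?addr0// => k ks; apply: sub; rewrite mem_cat ks//.
  by rewrite orbT.
- exists s0 => s us sub; rewrite parseval_defectZ//; last exact: L2_trigpoly.
  by rewrite h0// mulr0.
Qed.

(** The pairing and, through Bessel, the finite sum obey the same bound, hence the factor 2. The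
    bound does not depend on [s]. *)
Lemma normc_parseval_defect_le s f g (r : R) : uniq s -> L2 f -> L2 g -> 0 < r ->
  Normc.normc (parseval_defect s f g) <= 2 * (r * sqnorm f + r^-1 * sqnorm g).
Proof.
move=> us hf hg r0; rewrite mulr2n mulrDl mul1r.
rewrite (le_trans (le_normcD _ _))// lerD// ?normc_braket_le// normcN.
rewrite (le_trans (normc_sum _ _))//.
apply: (@le_trans _ _ (r * \sum_(k <- s) Normc.normc (braket (fourier k) f) ^+ 2 +
   r^-1 * \sum_(k <- s) Normc.normc (braket (fourier k) g) ^+ 2)); last first.
  by rewrite lerD// ler_wpM2l ?bessel// ?invr_ge0 ltW.
rewrite !mulr_sumr -big_split; apply: ler_sum => k _.
apply: (le_trans _ (normc_mul_le (braket (fourier k) f) (braket (fourier k) g) r0)).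
by have := normc_ge0 (conjc (braket (fourier k) f) * braket (fourier k) g); lra.
Qed.

Lemma EFin_sqnorm f : L2 f -> (sqnorm f)%:E = esqnorm f.
Proof.
move=> /L2P[_ jf]; rewrite /sqnorm /Rintegral fineK//.
exact: (integrable_fin_num measurable_domI jf).
Qed.

Lemma parseval f g (e : R) : L2 f -> L2 g -> 0 < e ->
  exists s0, forall s, uniq s -> {subset s0 <= s} ->
    Normc.normc (parseval_defect s f g) < e.
Proof.
(* The weight [r] is fixed first, making the term in [g] less than e/4; [p] is then chosen so close
   to [f] that r times the squared distance is also below e/4. The summand 1 covers a vanishing
   [g]. *)
move=> hf hg e0; pose r := 4 * (sqnorm g + 1) / e.
have g1 : 0 < sqnorm g + 1 by rewrite ltr_wpDl// sqnorm_ge0.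
have r0 : 0 < r by rewrite divr_gt0// mulr_gt0.
have e4 : 0 < e / 4 by rewrite divr_gt0.
have er0 : 0 < e / 4 / r by exact: divr_gt0.
have [_ af] := approximable_L2 hf; have [p tp] := af _ er0.
have hp := L2_trigpoly tp; have hfp := L2B hf hp.
rewrite -EFin_sqnorm// lte_fin => fp; have [s0 h0] := parseval_defect_trigpoly tp hg.
exists s0 => s us sub.
rewrite (_ : f = fun y => (f y - p y) + p y); last first.
  by apply/funext => y; rewrite subrK.
rewrite parseval_defectD// (h0 s us sub) addr0.
rewrite (le_lt_trans (normc_parseval_defect_le us hfp hg r0))//.
have h1 : r * sqnorm (fun y => f y - p y) < e / 4 by rewrite mulrC -ltr_pdivlMr.
have h2 : r^-1 * sqnorm g < e / 4.
  have -> : r^-1 * sqnorm g = e / 4 * (sqnorm g / (sqnorm g + 1)).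
    by rewrite /r; field; rewrite !gt_eqF.
  rewrite -[ltRHS]mulr1 ltr_pM2l ?divr_gt0// ltr_pdivrMr// mul1r.
  by rewrite ltrDl.
lra.
Qed.

Lemma eq_L2 f g : (forall y, D y -> f y = g y) -> L2 f -> L2 g.
Proof.
move=> fg /L2P[[mr mi] jf]; apply/L2P; split; first split.
- by apply: eq_measurable_fun mr => y /set_mem Dy; rewrite fg.
- by apply: eq_measurable_fun mi => y /set_mem Dy; rewrite fg.
- apply: eq_integrable jf; first exact: measurable_domI.
  by move=> y /set_mem Dy /=; rewrite fg.
Qed.

Lemma sqrt2V_le1 : (Num.sqrt 2 : R)^-1 <= 1.
Proof. by rewrite invf_le1 ?sqrtr_gt0// -[leLHS]sqrtr1 ler_sqrt// ler1n. Qed.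

Lemma normc_conv_term_le f g x k : Normc.normc (conv_term fourier f g x k) <=
  Normc.normc (braket (fourier k) f) ^+ 2 + Normc.normc (braket (fourier k) g) ^+ 2.
Proof.
rewrite /conv_term Normc.normcM normc_fourier Normc.normcM.
move: (normc_ge0 (braket (fourier k) f)) (normc_ge0 (braket (fourier k) g)).
set a := Normc.normc (braket (fourier k) f); set b := Normc.normc (braket (fourier k) g).
move: a b => a b a0 b0.
rewrite (@le_trans _ _ (a * b))//; last by nra.
by rewrite -[leRHS]mulr1 ler_wpM2l ?mulr_ge0// sqrt2V_le1.
Qed.

(** Each term is at most the sum of the two squared coefficients, so Bessel bounds all finite
    partial sums uniformly. *)
Lemma abs_summable_conv_term f g x : L2 f -> L2 g ->
  abs_summable (conv_term fourier f g x).
Proof.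
move=> hf hg; rewrite /abs_summable /summable.
apply: (@le_lt_trans _ _ (sqnorm f + sqnorm g)%:E); last exact: ltry.
apply: ge_ereal_sup => _ [A [finA _] <-]; rewrite fsbig_finite//.
under eq_bigr do rewrite gee0_abs ?lee_fin ?normc_ge0//.
rewrite sumEFin lee_fin.
apply: le_trans (_ : _ <= \sum_(k <- finmap.enum_fset (fset_set A))
   (Normc.normc (braket (fourier k) f) ^+ 2 + Normc.normc (braket (fourier k) g) ^+ 2)) _.
  by apply: ler_sum => k _; exact: normc_conv_term_le.
by rewrite big_split lerD// bessel// finmap.fset_uniq.
Qed.

(** The left side is the integral of fhat(x - y) e_k(y). Replacing y by x - y over a full period
    gives that of fhat(y) e_k(x - y), where [fhat] is [f] on [domI] and [fourier_sub] splits e_k. *)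
Lemma braket_periodic_reflect f (fhat : R -> R[i]) x k : L2 f ->
  periodic_extension f fhat -> D x ->
  conjc (braket (fourier k) (fun y => conjc (fhat (x - y)))) =
  (Num.sqrt 2)%:C * (braket (fourier k) f * fourier k x).
Proof.
move=> hf [pf ef] Dx; have hk := @L2_fourier R k.
have hfh : L2 fhat by apply: eq_L2 hf => y Dy; rewrite ef.
have hv := L2J (L2_periodic_reflect pf Dx hfh).
rewrite braketJ// /braket.
pose F t := fhat t * fourier k (x - t).
have pk y : fourier k (x - (y + 2)) = fourier k (x - y).
  by rewrite -[LHS]fourier_periodic; congr (fourier k _); ring.
have pF y : F (y + 2) = F y by rewrite /F pf pk.
have mF : cmeasurable F.
  apply: cmeasurableM; first exact: L2_cmeasurable.
  by apply/L2_cmeasurable/L2_periodic_reflect => // y; exact: fourier_periodic.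
transitivity (cintegral D (fun y => F (x - y))).
  by apply: eq_cintegral => y _; rewrite /F conjcK subKr.
rewrite cintegral_periodic//.
transitivity (cintegral D (fun y => (Num.sqrt 2)%:C * fourier k x * (conjc (fourier k y) * f y))).
  by apply: eq_cintegral => y Dy; rewrite /F ef// fourier_sub; ring.
by rewrite cintegralZ; [ring|exact: L2_cintegrable].
Qed.

End Parseval.

Theorem mainTheorem13 (R : realType) (C u Chat : R -> R[i])
    (hC : L2 C) (hu : L2 u)
    (hChat : periodic_extension C Chat)
    (x : R) (hx : domI x) :
  [/\ abs_summable (conv_term fourier C u x),
      cintegrable domI (fun y => Chat (x - y) * u y)
    & basis_conv fourier C u x =
      (Num.sqrt 2)^-1%:C *
      cintegral domI (fun y => Chat (x - y) * u y)].
Proof.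
have hCh : L2 Chat by apply: eq_L2 hC => y Dy; rewrite hChat.2.
have hv := L2J (L2_periodic_reflect hChat.1 hx hCh).
(* The double conjugation exhibits the convolution integral as the pairing of conj(Chat(x - y)) with
   [u]. *)
have vE : (fun y => Chat (x - y) * u y) =
    (fun y => conjc (conjc (Chat (x - y))) * u y).
  by apply/funext => y; rewrite conjcK.
split; first exact: abs_summable_conv_term.
  by rewrite vE; exact: L2_cintegrable.
set I := cintegral _ _.
have defect s : parseval_defect s (fun y => conjc (Chat (x - y))) u =
    I - (Num.sqrt 2)%:C * \sum_(k <- s) conv_term fourier C u x k.
  rewrite /parseval_defect /braket -vE -/I mulr_sumr; congr (_ - _).
  apply: eq_bigr => k _; rewrite -/(braket _ _) -/(braket _ _).
  by rewrite (braket_periodic_reflect k hC hChat hx) /conv_term; ring.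
rewrite /basis_conv /summability.sum.
have PF := @summability.totally_filter int.
refine (@cvg_lim (R[i]^o) (@norm_hausdorff _ _) _ _ PF _ _ _).
apply/cvgrPdist_lt => e e0.
(* The radius [e] is an element of R[i]; its positivity forces it to be real, and [parseval] is
   applied to its real part. *)
have e0' : 0 < complex.Re e by move: e0; rewrite ltcE => /andP[].
have eE : e = (complex.Re e)%:C.
  by apply: complex_ext => //=; move: e0; rewrite ltcE => /andP[/eqP].
have [s0 h0] := parseval hv hu e0'.
(* Every finite set containing [s0] has a duplicate-free enumeration containing [s0], as [parseval]
   asks. *)
exists (finmap.seq_fset tt s0) => // A /= /finmap.fsubsetP sub.
have {}sub : {subset s0 <= finmap.enum_fset A}.
  move=> k ks; have : k \in finmap.seq_fset tt s0 by rewrite finmap.seq_fsetE.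
  exact: sub.
have := h0 _ (finmap.fset_uniq A) sub; rewrite defect => lte.
rewrite /summability.partial_sum -(finmap.big_seq_fsetE _ _ predT)/=.
set S := \sum_(k <- _) _ in lte *.
have s2 : (Num.sqrt 2)^-1%:C * (Num.sqrt 2)%:C = 1 :> R[i].
  by rewrite -rmorphM/= mulVf// sqrt2_neq0.
(* The error of the partial sum is the Parseval defect divided by sqrt 2, hence no larger in
   modulus. *)
rewrite (_ : _ - _ = (Num.sqrt 2)^-1%:C * (I - (Num.sqrt 2)%:C * S)); last first.
  by rewrite mulrBr mulrA s2 mul1r.
set w := (_ * (I - _)); rewrite eE.
suff : (Normc.normc w)%:C < (complex.Re e)%:C by [].
rewrite ltcR; apply: le_lt_trans lte.
by rewrite Normc.normcM normc_real ler_piMl ?normc_ge0// ger0_norm ?invr_ge0 ?sqrtr_ge0// sqrt2V_le1.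
Qed.
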